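(* $\mathbb{E}$ and $\overline{\mathbb{E}}$ are starlike about $(0,0,0)$, but neither of them is circled.
   Context: The tetrablock is $\mathbb{E}=\{x\in\mathbb{C}^3: 1-x_1z-x_2w+x_3zw\ne0 \text{ whenever } |z|\le1,\ |w|\le1\}$, and $\overline{\mathbb{E}}$ is its closure in $\mathbb{C}^3$. A set $S\subset\mathbb{C}^3$ is starlike about $0$ if $rx\in S$ whenever $x\in S$ and $0\le r\le1$; it is circled if $\omega x\in S$ whenever $x\in S$ and $\omega\in\mathbb{C}$, $|\omega|=1$. *)

(* Defs.v *)
From mathcomp Require Import all_boot all_order all_algebra.
From mathcomp Require Import complex.
From mathcomp Require Import all_classical all_reals all_analysis.
Set Implicit Arguments.
Unset Strict Implicit.
Unset Printing Implicit Defensive.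
Import Order.TTheory GRing.Theory Num.Theory.
Import numFieldNormedType.Exports.
Local Open Scope classical_set_scope.
Local Open Scope complex_scope.
Local Open Scope ring_scope.

(* [R[i]] is not itself registered as a topological space; the norm topology
   is inherited from its [numFieldType] structure. *)
Definition cplx (R : realType) : numFieldType := R[i].

Definition tetrablock (R : realType) : set 'rV[cplx R]_3 :=
  [set x | forall z w : cplx R, `|z| <= 1 -> `|w| <= 1 ->
    1 - x 0 0 * z - x 0 1 * w + x 0 2%:R * z * w != 0].

Definition starlike0 (R : realType) (S : set 'rV[cplx R]_3) : Prop :=
  forall (x : 'rV[cplx R]_3) (r : R), S x -> 0 <= r -> r <= 1 ->
    S ((r%:C : cplx R) *: x).

Definition circled (R : realType) (S : set 'rV[cplx R]_3) : Prop :=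
  forall (x : 'rV[cplx R]_3) (omega : cplx R), S x -> `|omega| = 1 ->
    S (omega *: x).

(* Main.v *)
(** Proof idea: [x] lies in the tetrablock iff [|x_2 - x_3 z| < |1 - x_1 z|] for
    all [|z| <= 1]; in particular [|x_1| <= 1].  Since
    [r |1 - a| <= |1 - r a|] whenever [|a| <= 1] and [0 <= r <= 1], this condition
    is inherited by [r x].  The closure follows by continuity of scaling.
    The point [(1/2, 1/2, 1/4)] lies in the tetrablock because the defining
    polynomial factors, while its opposite violates the condition at [z = -1]
    with a margin, hence is not even in the closure. *)
Require Import Defs.
From mathcomp Require Import all_boot all_order all_algebra.
From mathcomp Require Import complex.
From mathcomp Require Import all_classical all_reals all_analysis.
From mathcomp Require Import ring lra.
Import Order.TTheory GRing.Theory Num.Theory.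
Import numFieldNormedType.Exports.
Local Open Scope ring_scope.

(** The difference of the squared moduli is [(1 - r)^2 + 2 r (1 - r) (1 - Re a)], and
    [Re a <= |a| <= 1]. *)
Lemma norm_1B_scale (R : rcfType) (r : R) (a : R[i]) :
  0 <= r -> r <= 1 -> `|a| <= 1 ->
  r%:C%C * `|1 - a| <= `|1 - r%:C%C * a|.
Proof.
case: a => p q r0 r1 a1.
have p1 : p <= 1.
  move: a1; rewrite normc_def lecR /= => h.
  have pq1 : p ^+ 2 + q ^+ 2 <= 1 by rewrite -(ler_sqrt _ ler01) sqrtr1.
  by nra.
have -> : r%:C%C * `|1 - (p +i* q)%C| = `|r%:C%C * (1 - (p +i* q)%C)|.
  by rewrite normrM [`|r%:C%C|]ger0_norm // lecR.
rewrite !normc_def lecR ler_wsqrtr //=.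
rewrite -subr_ge0.
have -> : (1 - (r * p - 0 * q)) ^+ 2 + (0 - (r * q + 0 * p)) ^+ 2 -
    ((r * (1 - p) - 0 * (0 - q)) ^+ 2 + (r * (0 - q) + 0 * (1 - p)) ^+ 2) =
  (1 - r) ^+ 2 + 2%:R * (r * (1 - r) * (1 - p)) by ring.
by rewrite addr_ge0 ?sqr_ge0 // !mulr_ge0 ?subr_ge0.
Qed.

(** Otherwise the polynomial, which is affine in [w], has the root [w = (1 - x_1 z) / (x_2 - x_3 z)]
    in the closed disc. *)
Lemma tetrablock_nle (R : realType) (x : 'rV[cplx R]_3) (z : cplx R) :
  tetrablock x -> `|z| <= 1 ->
  ~~ (`|1 - x 0 0 * z| <= `|x 0 1 - x 0 2%:R * z|).
Proof.
move=> Ex z1; apply/negP => le_nd.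
(* If the denominator vanishes, so does the numerator, and [w = 0] is already a root. *)
have [d0|d0] := eqVneq (x 0 1 - x 0 2%:R * z) 0.
  have := Ex z 0 z1; rewrite normr0 ler01 => /(_ isT) /negP; apply.
  move: le_nd; rewrite d0 normr0 normr_le0 => /eqP n0.
  by rewrite !mulr0 subr0 addr0 n0.
have w1 : `|(1 - x 0 0 * z) / (x 0 1 - x 0 2%:R * z)| <= 1.
  by rewrite normf_div ler_pdivrMr ?normr_gt0 // mul1r.
have /negP := Ex _ _ z1 w1; apply; apply/eqP.
by field.
Qed.

(** If [|x_1| > 1], the polynomial vanishes at [z = 1 / x_1], [w = 0]. *)
Lemma tetrablock_norm0_le1 (R : realType) (x : 'rV[cplx R]_3) :
  tetrablock x -> `|x 0 0| <= 1.
Proof.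
move=> Ex; rewrite real_leNgt ?normr_real ?real1 //; apply/negP => x1.
have x0 : x 0 0 != 0 by rewrite -normr_gt0 (lt_trans ltr01).
have z1 : `|(x 0 0)^-1| <= 1.
  by rewrite normfV invf_le1 ?normr_gt0 // ltW.
have := Ex _ 0 z1; rewrite normr0 ler01 => /(_ isT) /negP; apply.
by rewrite divff // !mulr0 subrr subr0 addr0.
Qed.

Lemma starlike0_tetrablock (R : realType) : starlike0 (@tetrablock R).
Proof.
move=> x r Ex r0 r1 z w z1 w1; rewrite !mxE; apply/eqP => eq0.
have [r00|rn0] := eqVneq r 0.
  move: eq0; rewrite r00 !mul0r !subr0 addr0; exact/eqP/oner_neq0.
have rC0 : 0 < (r%:C%C : cplx R) by rewrite ltcR lt_def rn0.
have xz1 : `|x 0 0 * z| <= 1.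
  by rewrite normrM mulr_ile1 // tetrablock_norm0_le1.
have /negP := tetrablock_nle _ _ _ Ex z1; apply.
rewrite -(ler_pM2l rC0); apply: le_trans (norm_1B_scale _ _ _ r0 r1 xz1) _.
(* This is the assumed vanishing at [r x], solved for the terms without [w]; since [|w| <= 1], it
   bounds the modulus by [r |x_2 - x_3 z|]. *)
have -> : 1 - r%:C%C * (x 0 0 * z) = r%:C%C * (x 0 1 - x 0 2%:R * z) * w.
  apply/eqP; rewrite -subr_eq0 -eq0; apply/eqP; ring.
rewrite !normrM [`|r%:C%C|]gtr0_norm // ler_piMr //.
by rewrite mulr_ge0 // ltW.
Qed.

Lemma starlike0_closure (R : realType) (S : set 'rV[cplx R]_3) :
  starlike0 S -> starlike0 (closure S).
Proof.
move=> starS x r clx r0 r1 B nB.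
have /= := @scaler_continuous (cplx R) 'rV[cplx R]_3 r%:C%C x B nB.
by move=> /clx[y [Sy By]]; exists (r%:C%C *: y); split => //; exact: starS.
Qed.

Definition witness (R : realType) : 'rV[cplx R]_3 :=
  \row_j (if j == 2%:R then 4%:R^-1 else 2%:R^-1).

Lemma tetrablock_witness (R : realType) : tetrablock (witness R).
Proof.
(* Each factor vanishes only at [2], outside the closed disc. *)
have half (z : cplx R) : `|z| <= 1 -> 1 - 2%:R^-1 * z != 0.
  move=> z1; rewrite subr_eq0; apply/eqP => h.
  have : `|2%:R^-1 * z| < 1.
    rewrite normrM normfV normr_nat.
    by rewrite (le_lt_trans (ler_piMr _ z1)) ?invr_ge0 ?ler0n ?invf_lt1 ?ltr1n.
  by rewrite -h normr1 ltxx.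
move=> z w z1 w1; rewrite !mxE /=.
have -> : 1 - 2%:R^-1 * z - 2%:R^-1 * w + 4%:R^-1 * z * w =
  (1 - 2%:R^-1 * z) * (1 - 2%:R^-1 * w) :> cplx R by field.
by rewrite mulf_neq0 ?half.
Qed.

Lemma opp_witness_notin_closure (R : realType) :
  ~ closure (@tetrablock R) (- witness R).
Proof.
(* At [z = -1] the opposite point gives [1/2] for [|1 - x_1 z|] and [3/4] for [|x_2 - x_3 z|].
   Moving each coordinate by at most [e] closes the gap by at most [3 e], so [e = 1/24] leaves
   [1/8]. *)
have e0 : 0 < 24%:R^-1 :> cplx R by rewrite invr_gt0 ltr0n.
move=> /(_ _ (nbhsx_ballx _ _ e0))[x [Ex [_ bx]]].
have z1 : `|- 1 : cplx R| <= 1 by rewrite normrN1.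
have /negP := tetrablock_nle _ _ _ Ex z1; apply.
have near j : `|(- witness R) 0 j - x 0 j| <= 24%:R^-1.
  by have := bx 0 j; rewrite -ball_normE => /ltW.
have := (near 0, near 1, near 2%:R); rewrite !mxE /= => -[[ha hb] hc].
apply: (@le_trans _ _ (2%:R^-1 + 24%:R^-1)).
  have -> : 1 - x 0 0 * -1 = 2%:R^-1 - (- 2%:R^-1 - x 0 0) by field.
  by rewrite (le_trans (ler_normB _ _)) // lerD // ger0_norm ?invr_ge0 ?ler0n.
have bc : 3%:R / 4%:R <= `|x 0 1 - x 0 2%:R * -1| + 24%:R^-1 + 24%:R^-1.
  have -> : 3%:R / 4%:R = `|x 0 1 - x 0 2%:R * -1
      + (- 2%:R^-1 - x 0 1) + (- 4%:R^-1 - x 0 2%:R)|.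
    rewrite -[LHS]ger0_norm ?divr_ge0 ?ler0n // -normrN; congr `|_|.
    by field.
  apply: le_trans (ler_normD _ _) (lerD _ hc).
  exact: le_trans (ler_normD _ _) (lerD _ hb).
apply: le_trans (_ : 3%:R / 4%:R - 24%:R^-1 - 24%:R^-1 <= _); last first.
  by rewrite !lerBlDr.
rewrite -subr_ge0.
have -> : 3%:R / 4%:R - 24%:R^-1 - 24%:R^-1 - (2%:R^-1 + 24%:R^-1) = 8%:R^-1 :> cplx R
  by field.
by rewrite invr_ge0 ler0n.
Qed.

Theorem theorem2p7 (R : realType) :
  [/\ starlike0 (@tetrablock R), starlike0 (closure (@tetrablock R)),
      ~ circled (@tetrablock R) & ~ circled (closure (@tetrablock R))].
Proof.
(* Rotation by [-1] refutes both claims: the opposite of the witness is outside the closure, hence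
   outside the tetrablock too. *)
have N1 : `|- 1 : cplx R| = 1 by rewrite normrN1.
split.
- exact: starlike0_tetrablock.
- exact/starlike0_closure/starlike0_tetrablock.
- move=> /(_ _ _ (tetrablock_witness R) N1); rewrite scaleN1r.
  by move=> /subset_closure; exact: opp_witness_notin_closure.
- move=> /(_ _ _ (subset_closure (tetrablock_witness R)) N1); rewrite scaleN1r.
  exact: opp_witness_notin_closure.
Qed.
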